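(* Let $(X,d)$ be a compact metric space and let $G$ be an abelian semigroup of continuous self maps of $X$, with generating family $\{g_\alpha\}_\alpha$. Then $$X\setminus CR(G)=\bigcup_{A}\,[B(A)\setminus A],$$ where $A$ varies over the collection of all attractors of $G$, $B(A)$ denotes the basin of attraction of $A$, and $CR(G)$ denotes the chain recurrent set of $G$.
   Context: A semigroup $G$ on $X$ is a set of (non-identity) continuous self maps of $X$ closed under composition; it is generated by a family $\{g_\alpha\}_\alpha$ of continuous self maps if every element of $G$ is a finite composition of members (with repetitions allowed) of the family. $G$ is abelian if its elements commute under composition. Put $\widehat G=G\cup\{\mathrm{identity}\}$. Chains: for $a,b\in X$, $g\in G$, $\epsilon>0$, an $(\epsilon,g)$-chain from $a$ to $b$ is a finite sequence $(a=x_1,\ldots,x_{n+1}=b;\,g_1,\ldots,g_n)$ with $n\ge 1$, $x_i\in X$, $g_i\in\widehat G$ and $d(g_i\circ g(x_i),x_{i+1})<\epsilon$ for $i=1,\ldots,n$. A point $x\in X$ is chain recurrent for $G$ if for every $\epsilon>0$ and every $g\in G$ there is an $(\epsilon,g)$-chain from $x$ to itself; $CR(G)$ is the set of all chain recurrent points. Unbounded sequences and $\omega$-limit points: a sequence $(f_{n_k})_k$ in $G$ is unbounded if $n_k\to\infty$ as $k\to\infty$ and there is a fixed generator $g_{\alpha_0}\in\{g_\alpha\}_\alpha$ such that each $f_{n_k}$ consists of exactly $n_k$ iterates of $g_{\alpha_0}$, that is, $f_{n_k}=h_1\circ g_{\alpha_0}\circ h_2\circ g_{\alpha_0}\circ\cdots\circ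 h_{n_k}\circ g_{\alpha_0}\circ h_{n_k+1}$ where each $h_i\in\widehat G$ is independent of $g_{\alpha_0}$ (it is the identity or written as a composition of generators other than $g_{\alpha_0}$). A point $z\in X$ is an $\omega$-limit point for $x\in X$ if $f_{n_k}(x)\to z$ as $k\to\infty$ for some unbounded sequence $(f_{n_k})$ in $G$; $\omega(x)$ is the set of all $\omega$-limit points for $x$. Attractors: a nonempty open set $U\subset X$ is a trapping region for $G$ if there exists $h\in G$ such that the set $\widetilde U:=\{f(h(x)):x\in U,\ f\in\widehat G\}$ satisfies $\mathrm{cl}(\widetilde U)\subset U$. The attractor for $G$ determined by the trapping region $U$ (with such an $h$) is the set $A$ of all $x\in X$ such that for every open subset $V$ of $X$ containing $x$ there is some unbounded sequence $(f_{n_k})_k$ in $G$ with $V\cap f_{n_k}(h(U))\neq\emptyset$ for infinitely many $k\in\mathbb N$. The basin of attraction of an attractor $A$ is $B(A):=\{x\in X:\omega(x)\cap A\neq\emptyset\}$. *)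

(* Defs.v *)
From HB Require Import structures.
From mathcomp Require Import all_boot all_order all_algebra.
From mathcomp Require Import all_classical all_reals all_analysis.

Set Implicit Arguments.
Unset Strict Implicit.
Unset Printing Implicit Defensive.

Import Order.TTheory GRing.Theory Num.Theory.
Local Open Scope classical_set_scope.
Local Open Scope ring_scope.

(* Compositions of one or more members of [S]. *)
Inductive finite_composition (X : Type) (S : set (X -> X)) : set (X -> X) :=
| fc_member f : S f -> finite_composition S f
| fc_comp f g : finite_composition S f -> finite_composition S g ->
    finite_composition S (f \o g).

Section semigroup.
Context {X : topologicalType}.
Implicit Types (G Gen : set (X -> X)) (f g h : X -> X).

Record semigroup G : Prop := Semigroup {
  semigroup_continuous : forall f, G f -> continuous f;
  semigroup_nonid : ~ G idfun;
  semigroup_comp : forall f g, G f -> G g -> G (f \o g)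
}.

Definition abelian_semigroup G : Prop :=
  semigroup G /\ forall f g, G f -> G g -> f \o g = g \o f.

(* The generators belong to [G]: [G] is exactly the set of their
   compositions. *)
Definition generated_by G Gen : Prop := G = finite_composition Gen.

Definition adjoin_id G : set (X -> X) := G `|` [set idfun].

Definition independent_of G Gen g h : Prop :=
  adjoin_id G h /\ (h = idfun \/ finite_composition (Gen `\ g) h).

(* f = h_0 \o g \o h_1 \o g \o ... \o h_(n-1) \o g \o h_n *)
Definition exactly_n_iterates G Gen g (n : nat) f : Prop :=
  exists h : nat -> X -> X,
    (forall i, (i <= n)%N -> independent_of G Gen g (h i)) /\
    f = foldr (fun i k => h i \o g \o k) (h n) (iota 0 n).

Definition unbounded_seq G Gen (f : nat -> X -> X) : Prop :=
  (forall k, G (f k)) /\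
  exists (n : nat -> nat) (g : X -> X),
    [/\ n @ \oo --> \oo, Gen g &
        forall k, exactly_n_iterates G Gen g (n k) (f k)].

Definition omega_limit G Gen (x : X) : set X :=
  [set z | exists f : nat -> X -> X, unbounded_seq G Gen f /\ (f k x @[k --> \oo] --> z)].

Definition trapping_region G (U : set X) h : Prop :=
  [/\ U !=set0, open U, G h &
      closure [set f (h x) | f in adjoin_id G & x in U] `<=` U].

Definition attractor_of G Gen (U : set X) h : set X :=
  [set x | forall V : set X, open V -> V x ->
     exists f : nat -> X -> X, unbounded_seq G Gen f /\
       infinite_set [set k | V `&` (f k @` (h @` U)) !=set0]].

Definition attractor G Gen (A : set X) : Prop :=
  exists U h, trapping_region G U h /\ A = attractor_of G Gen U h.

Definition basin G Gen (A : set X) : set X :=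
  [set x | omega_limit G Gen x `&` A !=set0].

End semigroup.

Section chain_recurrence.
Context {R : realType} {X : metricType R}.
Implicit Types (G : set (X -> X)) (g : X -> X).

(* The chain is (x 0, ..., x n; gs 0, ..., gs (n-1)); values of [x] and [gs]
   at larger indices are irrelevant. *)
Definition has_chain G (e : R) g (a b : X) : Prop :=
  exists (n : nat) (x : nat -> X) (gs : nat -> X -> X),
    [/\ (1 <= n)%N, x 0%N = a, x n = b &
        forall i, (i < n)%N ->
          adjoin_id G (gs i) /\ mdist (gs i (g (x i))) (x i.+1) < e].

Definition chain_recurrent G : set X :=
  [set x | forall (e : R) g, 0 < e -> G g -> has_chain G e g x x].

End chain_recurrence.

(* Main.v *)
Require Import Defs.
From mathcomp Require Import all_boot all_order all_algebra.
From mathcomp Require Import all_classical all_reals all_analysis.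
From mathcomp Require Import lra.
Import Order.TTheory GRing.Theory Num.Theory.
Import metricType_numDomainType.
Local Open Scope classical_set_scope.

(** Both inclusions rest on one dictionary: because [G] is abelian, every
    element of [G] can be rewritten with all the copies of a chosen generator
    [p] in front, so a sequence whose [k]-th term has the form
    [p^(k+1) \o f_k], for arbitrary [f_k] in [G] or the identity, is unbounded
    ([unbounded_seq_iter]).

    If [x] is not chain recurrent, some [e] and [h] admit no [(e,h)]-chain from
    [x] to [x]. The set [U] of points reached from [x] by [(e,h)]-chains is a
    trapping region for [h], since a point within [e] of [f (h y)], [y] in [U],
    is reached by one more step ([trapping_region_reachable]). It does not
    contain [x], hence neither does its attractor, which lies inside [U]. But
    [h x] is in [U], so the iterates of [h (h x)] under a generator are points
    of images of [h(U)]; by compactness they accumulate at a point that is both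
    in [omega(x)] and in the attractor ([omega_limit_meets_attractor]).

    Conversely, let [x] be chain recurrent and let [omega(x)] meet the attractor
    of [(U, h)]. As the attractor lies in the open set [U], some [f] in [G] sends
    [x] into [U]. By compactness the points within some [e] of the trapped set
    are in [U]; therefore an [(e, h \o f \o p^k)]-chain that starts at [x] stays
    in [U], its first step entering [U] through [f x]. Its last step exhibits a
    point of [p^k (q (h(U)))], with [q] in [G] or the identity, close to the
    endpoint [x] ([trapped_chain]). Letting [k] vary puts [x] in the attractor
    ([recurrent_in_attractor]). *)

(** * Compactness *)

Lemma open_thickening_of_compact {R : realType} {X : metricType R}
    (K U : set X) :
  compact K -> open U -> K `<=` U ->
  exists2 e : R, (0 < e)%R & forall y z, K y -> (mdist y z < e)%R -> U z.
Proof.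
move=> /compact_near_coveringP Kcov Uopen KU.
have Ksmall : \forall e \near (0%R : R)^'+,
    K `<=` [set y | forall z : X, (mdist y z < e)%R -> U z].
  apply: Kcov => y Ky.
  have /nbhs_mdistP[r /= r0 rU] : nbhs y U.
    by exact: open_nbhs_nbhs (conj Uopen (KU _ Ky)).
  have r20 : (0 < r / 2)%R by rewrite divr_gt0.
  exists ([set y' | (mdist y y' < r / 2)%R], [set e : R | (e < r / 2)%R]).
    split => /=; first by apply/nbhs_mdistP; exists (r / 2)%R.
    exact: nbhs_right_lt.
  move=> [y' e] /= [yy' er] z y'z; apply: rU => /=.
  by apply: (le_lt_trans (metric_triangle _ y' _)); lra.
have [e [e0 Ke]] := filter_ex (filterI (@nbhs_right_gt R 0%R) Ksmall).
by exists e => // y z Ky; apply: Ke.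
Qed.

Lemma compact_cluster_index {T : topologicalType} (u : nat -> T) :
  compact [set: T] ->
  exists z : T, forall (N : nat) (V : set T),
    nbhs z V -> exists2 k, (N <= k)%N & V (u k).
Proof.
move=> Tcompact.
have [z [_ uz]] := Tcompact (u k @[k --> \oo])%classic _ filterT.
exists z => N V Vz.
have uN : (u k @[k --> \oo])%classic (u @` [set k | (N <= k)%N]).
  by exists N => // k Nk; exists k.
by have [_ [[k Nk <-] Vk]] := uz _ _ uN Vz; exists k.
Qed.

(** * Words in an abelian semigroup *)

Section abelian.
Context {X : topologicalType} {G Gen : set (X -> X)}.
Hypothesis abelG : abelian_semigroup G.
Hypothesis genG : generated_by G Gen.

Lemma adjoin_id_comp f g :
  adjoin_id G f -> adjoin_id G g -> adjoin_id G (f \o g).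
Proof.
case=> [Gf|->]; case=> [Gg|->]; [|by left|by left|by right].
by left; apply: semigroup_comp abelG.1 _ _ Gf Gg.
Qed.

Lemma comp_adjoin_id_l f g : adjoin_id G f -> G g -> G (f \o g).
Proof. by case=> [Gf|->] // Gg; apply: semigroup_comp abelG.1 _ _ Gf Gg. Qed.

Lemma adjoin_id_comm f g x :
  adjoin_id G f -> adjoin_id G g -> f (g x) = g (f x).
Proof.
case=> [Gf|->] // [Gg|->] //.
by have /(congr1 (@^~ x)) := abelG.2 f g Gf Gg.
Qed.

Lemma adjoin_id_iter p k : adjoin_id G p -> adjoin_id G (iter k p).
Proof.
move=> Gp; elim: k => [|k IHk]; first by right.
exact: (adjoin_id_comp p (iter k p)).
Qed.

Lemma generator_in_semigroup p : Gen p -> G p.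
Proof. by move=> Genp; rewrite genG; exact: fc_member. Qed.

Lemma independent_of_id p : independent_of G Gen p idfun.
Proof. by split; [right|left]. Qed.

Lemma independent_of_comp p h h' :
  independent_of G Gen p h -> independent_of G Gen p h' ->
  independent_of G Gen p (h \o h').
Proof.
move=> [Gh ih] [Gh' ih']; split; first exact: adjoin_id_comp.
case: ih => [->//|ih]; case: ih' => [->|ih']; first by right.
by right; exact: fc_comp.
Qed.

Lemma factor_out_generator p f : Gen p -> adjoin_id G f ->
  exists m h, independent_of G Gen p h /\ f = iter m p \o h.
Proof.
move=> Genp [Gf|->]; last first.
  by exists 0%N, idfun; split => //; exact: independent_of_id.
have Gp : adjoin_id G p by left; exact: generator_in_semigroup.
have : finite_composition Gen f by rewrite -genG.
elim=> {f Gf} [f Genf|f f' _ [m [h [ih ->]]] _ [m' [h' [ih' ->]]]].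
  have [->|fp] := pselect (f = p).
    by exists 1%N, idfun; split => //; exact: independent_of_id.
  exists 0%N, f; split => //; split; first by left; exact: generator_in_semigroup.
  by right; apply: fc_member.
exists (m + m')%N, (h \o h'); split; first exact: independent_of_comp.
apply/funext => x /=; rewrite iterD; congr (iter m p _).
exact: adjoin_id_comm ih.1 (adjoin_id_iter p m' Gp).
Qed.

Lemma exactly_n_iterates_iter p n h :
  independent_of G Gen p h -> exactly_n_iterates G Gen p n (iter n p \o h).
Proof.
move=> ih; exists (fun i => if (i < n)%N then idfun else h); split.
  by move=> i _; case: ifP => // _; exact: independent_of_id.
rewrite ltnn.
(* The fold is generalized to any list of indices below [n], so that induction
   goes through. *)
have sfold s : all (gtn n) s -> foldr (fun i k =>
    (if (i < n)%N then idfun else h) \o p \o k) h s = iter (size s) p \o h.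
  elim: s => [|i s IHs] //= /andP[ilt sn]; rewrite IHs //.
  by rewrite ilt.
rewrite sfold ?size_iota //.
by apply/allP => i; rewrite mem_iota add0n => /andP[].
Qed.

(** The copies of [p] must be counted exactly, and [f k] may itself contain [p]:
    commutation brings those copies to the front, and the total count, at least
    [k.+1], still tends to infinity. *)
Lemma unbounded_seq_iter p (f : nat -> X -> X) :
  Gen p -> (forall k, adjoin_id G (f k)) ->
  unbounded_seq G Gen (fun k => iter k.+1 p \o f k).
Proof.
move=> Genp Gf; have Gp := generator_in_semigroup p Genp.
split=> [k|].
  have -> : iter k.+1 p \o f k = (iter k p \o f k) \o p.
    apply/funext => x /=; rewrite -iterS iterSr.
    by rewrite (adjoin_id_comm p (f k)) //; left.
  apply: comp_adjoin_id_l => //; apply: adjoin_id_comp => //.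
  by apply: adjoin_id_iter; left.
have /choice[m mP] : forall k, exists m, exists h,
    independent_of G Gen p h /\ f k = iter m p \o h.
  by move=> k; exact: factor_out_generator.
exists (fun k => k.+1 + m k)%N, p; split => //.
  apply/cvgnyPge => A; exists A => // k /= Ak.
  by rewrite addSn leqW // (leq_trans Ak) // leq_addr.
move=> k; have [h [ih ->]] := mP k.
have -> : iter k.+1 p \o (iter (m k) p \o h) = iter (k.+1 + m k) p \o h.
  by apply/funext => x /=; rewrite -iterD.
exact: exactly_n_iterates_iter.
Qed.

Lemma semigroup_has_generator h : G h -> exists p, Gen p.
Proof. by rewrite genG; elim=> [p Genp|//]; exists p. Qed.

End abelian.

(** * Attractors *)

Lemma attractor_sub_trapping_region {X : topologicalType}
    (G Gen : set (X -> X)) U h :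
  trapping_region G U h -> attractor_of G Gen U h `<=` U.
Proof.
move=> [_ _ _ clU] x Ax; apply: clU => V; rewrite nbhsE => -[W [Wo Wx] WV].
have [f [[Gf _] /infinite_setN0[k [y [Wy [_ [u Uu <-] fy]]]]]] := Ax W Wo Wx.
exists y; split; last exact: WV.
by exists (f k); [left|exists u].
Qed.

(** A single orbit provides the limit point: along the subsequence that
    converges to a cluster point [z] of [p^k (h (h x))], the maps [p^k \o h \o h]
    witness that [z] is in [omega(x)], and the maps [p^k], applied to [h (h x)] in
    [h(U)], witness that [z] is in the attractor. *)
Lemma omega_limit_meets_attractor {R : realType} {X : metricType R}
    (G Gen : set (X -> X)) (U : set X) h x :
  compact [set: X] -> abelian_semigroup G -> generated_by G Gen ->
  G h -> U (h x) ->
  omega_limit G Gen x `&` attractor_of G Gen U h !=set0.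
Proof.
move=> Xcompact abelG genG Gh Uhx.
have [p Genp] := semigroup_has_generator genG h Gh.
have Gp : adjoin_id G p by left; exact: generator_in_semigroup genG _ _.
have Gp' k : adjoin_id G (iter k p) by exact: adjoin_id_iter.
have [z zP] := compact_cluster_index (fun k => iter k p (h (h x))) Xcompact.
exists z; split.
  have /choice[r rP] : forall j : nat, exists r,
      (mdist z (iter (j.+1 + r) p (h (h x))) < j.+1%:R^-1)%R.
    move=> j; have [k jk dk] : exists2 k, (j.+1 <= k)%N &
        (mdist z (iter k p (h (h x))) < j.+1%:R^-1)%R.
      apply: (zP j.+1 [set y | (mdist z y < j.+1%:R^-1)%R]).
      by apply/nbhs_mdistP; exists (j.+1%:R^-1)%R => //=; rewrite invr_gt0.
    by exists (k - j.+1)%N; rewrite subnKC.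
  exists (fun j => iter j.+1 p \o (iter (r j) p \o (h \o h))); split.
    apply: unbounded_seq_iter => // j; apply: adjoin_id_comp => //.
    by apply: adjoin_id_comp => //; left.
  apply/cvgrPdist_lt => e e0.
  have := near_infty_natSinv_lt (PosNum e0); apply: filterS => j /= je.
  by rewrite -iterD -iterS -addSn (lt_trans (rP j)).
move=> V Vo Vz.
have /choice[r rP] : forall j : nat, exists r,
    V (iter (j.+1 + r) p (h (h x))).
  move=> j; have [k jk Vk] := zP j.+1 V (open_nbhs_nbhs (conj Vo Vz)).
  by exists (k - j.+1)%N; rewrite subnKC.
exists (fun j => iter j.+1 p \o iter (r j) p); split.
  exact: unbounded_seq_iter.
apply: (sub_infinite_set _ infinite_nat) => j _.
exists (iter (j.+1 + r j) p (h (h x))); split => //.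
by exists (h (h x)); [exists (h x)|rewrite iterD].
Qed.

(** * Chains *)

Section chains.
Context {R : realType} {X : metricType R} {G : set (X -> X)}.

(** This records the last step besides the invariance of [P], because the
    endpoint of a chain is only known to be close to an image of a point
    satisfying [P]. *)
Lemma has_chain_last_step {e : R} {g a b} (P : set X) :
  has_chain G e g a b -> P a ->
  (forall c d f, P c -> adjoin_id G f -> (mdist (f (g c)) d < e)%R -> P d) ->
  exists c f, [/\ P c, adjoin_id G f & (mdist (f (g c)) b < e)%R].
Proof.
case=> -[|n] [x [gs [n1 <- <- step]]] Px0 Pstep //.
have Px i : (i <= n)%N -> P (x i).
  elim: i => // i IHi ilt; have [Ggs lt_e] := step i (ltnW ilt).
  exact: Pstep (IHi (ltnW ilt)) Ggs lt_e.
have [Ggs lt_e] := step n (leqnn _).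
by exists (x n), (gs n); split => //; exact: Px.
Qed.

Lemma has_chain_one_step (e : R) g f a b :
  adjoin_id G f -> (mdist (f (g a)) b < e)%R -> has_chain G e g a b.
Proof.
move=> Gf lt_e; exists 1%N, (fun i => if i is 0%N then a else b), (fun=> f).
by split => // -[].
Qed.

Lemma has_chain_extend (e : R) g f a b c :
  has_chain G e g a b -> adjoin_id G f -> (mdist (f (g b)) c < e)%R ->
  has_chain G e g a c.
Proof.
move=> [n [x [gs [n1 x0 xn step]]]] Gf lt_e.
exists n.+1, (fun i => if (i <= n)%N then x i else c),
  (fun i => if (i < n)%N then gs i else f).
split; rewrite ?ltnn // => i; rewrite ltnS => ilen; rewrite ilen.
have [ltin|] := ltnP i n; first exact: step.
move=> lein; have eq_in : i = n by apply/eqP; rewrite eqn_leq ilen.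
by rewrite eq_in xn.
Qed.

Lemma open_reachable (e : R) g a : open [set b | has_chain G e g a b].
Proof.
rewrite openE => b ab.
have [|c d f [->|ac] Gf lt_e|c [f [Pc Gf lt_e]]] :=
    has_chain_last_step [set c | c = a \/ has_chain G e g a c] ab.
- by left.
- by right; exact: has_chain_one_step Gf lt_e.
- by right; exact: has_chain_extend ac Gf lt_e.
apply/nbhs_mdistP; exists (e - mdist (f (g c)) b)%R => /=.
  by rewrite subr_gt0.
move=> b' /= bb'.
have lt_e' : (mdist (f (g c)) b' < e)%R.
  by apply: (le_lt_trans (metric_triangle _ b _)); lra.
by case: Pc => [ca|ac]; [rewrite ca in lt_e'; exact: has_chain_one_step Gf lt_e'
                        |exact: has_chain_extend ac Gf lt_e'].
Qed.

Lemma trapping_region_reachable (e : R) h x :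
  (0 < e)%R -> G h ->
  trapping_region G [set b | has_chain G e h x b] h.
Proof.
move=> e0 Gh; split => //.
- exists (h x); apply: (@has_chain_one_step e h idfun); first by right.
  by rewrite mdistxx.
- exact: open_reachable.
- move=> z clz.
  have /clz[_ [[f Gf [b xb <-]] /= zb]] : nbhs z [set y | (mdist z y < e)%R].
    by apply/nbhs_mdistP; exists e.
  by apply: has_chain_extend xb Gf _; rewrite metric_sym.
Qed.

(** Moving [h] next to the point of [U] and leaving [f] on the left makes every
    step a step of the trapped set, and moving [k] in front shows the endpoint
    as close to [k (q (h u))]. From [x], which may lie outside [U], it is [f x]
    that plays the role of [u]. *)
Lemma trapped_chain {U : set X} {e : R} {h f k x b} :
  abelian_semigroup G -> G h -> adjoin_id G f -> adjoin_id G k ->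
  (forall q u d, adjoin_id G q -> U u -> (mdist (q (h u)) d < e)%R -> U d) ->
  U (f x) -> has_chain G e (h \o (f \o k)) x b ->
  exists u q, [/\ U u, adjoin_id G q & (mdist (k (q (h u))) b < e)%R].
Proof.
move=> abelG Gh0 Gf Gk trap Ufx xb.
have Gh : adjoin_id G h by left.
have shuffle c q : adjoin_id G q -> (c = x \/ U c) ->
    exists u q', [/\ U u, adjoin_id G q' & q (h (f (k c))) = k (q' (h u))].
  move=> Gq [->|Uc].
    exists (f x), q; split => //.
    by rewrite (adjoin_id_comm abelG f k) // (adjoin_id_comm abelG h k) //
      (adjoin_id_comm abelG q k).
  exists c, (q \o f); split => //; first exact: adjoin_id_comp.
  rewrite /= (adjoin_id_comm abelG f k) // (adjoin_id_comm abelG h k) //.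
  by rewrite (adjoin_id_comm abelG q k) // (adjoin_id_comm abelG h f).
have [|c d q Pc Gq lt_e|c [q [Pc Gq lt_e]]] :=
    has_chain_last_step [set c | c = x \/ U c] xb.
- by left.
- have [u [q' [Uu Gq' eq_q]]] := shuffle c q Gq Pc.
  right; apply: (trap (k \o q') u) => //; first exact: adjoin_id_comp.
  by rewrite /= -eq_q.
- have [u [q' [Uu Gq' eq_q]]] := shuffle c q Gq Pc.
  by exists u, q'; split => //; rewrite -eq_q.
Qed.

End chains.

(** * Chain recurrent points of a basin *)

Lemma recurrent_in_attractor {R : realType} {X : metricType R}
    (G Gen : set (X -> X)) (U : set X) h x :
  compact [set: X] -> abelian_semigroup G -> generated_by G Gen ->
  trapping_region G U h -> chain_recurrent G x ->
  (exists2 f, G f & U (f x)) -> attractor_of G Gen U h x.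
Proof.
move=> Xcompact abelG genG [_ Uo Gh clU] xCR [f Gf Ufx].
set T := [set f (h x) | f in adjoin_id G & x in U] in clU.
have clT : compact (closure T).
  exact: subclosed_compact (@closed_closure _ _) Xcompact _.
have [e e0 eU] := open_thickening_of_compact _ _ clT Uo clU.
move=> V Vo Vx.
have /nbhs_mdistP[r /= r0 rV] : nbhs x V by exact: open_nbhs_nbhs.
have [p Genp] := semigroup_has_generator genG h Gh.
have Gp k : adjoin_id G (iter k p).
  by apply: adjoin_id_iter => //; left; exact: generator_in_semigroup genG _ _.
pose d := Num.min e r.
have [d0 de dr] : [/\ (0 < d)%R, (d <= e)%R & (d <= r)%R].
  by rewrite lt_min e0 r0 !ge_min !lexx orbT.
have step k : exists q, adjoin_id G q /\
    exists2 u, U u & V (iter k.+1 p (q (h u))).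
  have Ghfp : G (h \o (f \o iter k.+1 p)).
    have -> : h \o (f \o iter k.+1 p) = (f \o iter k.+1 p) \o h.
      apply/funext => y /=; apply: (adjoin_id_comm abelG h (f \o iter k.+1 p)).
        by left.
      by apply: adjoin_id_comp => //; left.
    by apply: comp_adjoin_id_l => //; apply: adjoin_id_comp => //; left.
  have trap q u c : adjoin_id G q -> U u -> (mdist (q (h u)) c < d)%R -> U c.
    move=> Gq Uu lt_d; apply: (eU (q (h u))); last exact: lt_le_trans lt_d de.
    by apply: subset_closure; exists q => //; exists u.
  have [|u [q [Uu Gq lt_d]]] :=
      trapped_chain abelG Gh _ (Gp k.+1) trap Ufx (xCR d _ d0 Ghfp).
    by left.
  exists q; split => //; exists u => //; apply: rV => /=.
  by rewrite metric_sym; exact: lt_le_trans lt_d dr.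
have /choice[q qP] := step.
exists (fun k => iter k.+1 p \o q k); split.
  by apply: unbounded_seq_iter => // k; case: (qP k).
apply: (sub_infinite_set _ infinite_nat) => k _.
have [_ [u Uu Vu]] := qP k.
by exists (iter k.+1 p (q k (h u))); split => //; exists (h u) => //; exists u.
Qed.

Theorem theorem3p5 (R : realType) (X : metricType R) (I : Type)
    (g : I -> X -> X) (G : set (X -> X)) :
  compact [set: X] ->
  abelian_semigroup G ->
  generated_by G (range g) ->
  ~` chain_recurrent G =
  \bigcup_(A in attractor G (range g)) (basin G (range g) A `\` A).
Proof.
move=> Xcompact abelG genG; apply/seteqP; split=> x.
  move=> xNCR.
  have [e [h [e0 Gh noloop]]] :
      exists (e : R) h, [/\ (0 < e)%R, G h & ~ has_chain G e h x x].
    apply: contrapT => H; apply: xNCR => e h e0 Gh.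
    by apply: contrapT => noloop; apply: H; exists e, h.
  have trapU := trapping_region_reachable e h x e0 Gh.
  exists (attractor_of G (range g) [set b | has_chain G e h x b] h).
    by exists [set b | has_chain G e h x b], h.
  split; last by move/(attractor_sub_trapping_region _ _ _ _ trapU).
  apply: omega_limit_meets_attractor => //=.
  apply: (@has_chain_one_step _ _ _ e h idfun); first by right.
  by rewrite mdistxx.
move=> [_ [U [h [trapU ->]]] [[z [[f [[Gf _] fz]] Az]] xNA]] xCR.
apply: xNA; apply: recurrent_in_attractor => //.
have Uz := attractor_sub_trapping_region _ _ _ _ trapU _ Az.
have [_ Uo _ _] := trapU.
have near_U : \forall k \near \oo, U (f k x).
  exact: fz _ (open_nbhs_nbhs (conj Uo Uz)).
have [k Uk] := filter_ex near_U.
by exists (f k).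
Qed.
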